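(* Let $n\in\mathbb{Z}_+^d$ be a prebasis. For $f\in X_n$ such that $\mathrm{real}(f)$ is finite and for $v\in\mathbb{Z}^d$ it holds that $\mathrm{real}(\sigma_v(f))=m(n,-v)\,\mathrm{real}(f)$, where $m(n,-v)=\prod_{j=1}^d n[j]^{v[j]}$.
   Context: $\mathbb{N}=\{0,1,2,\dots\}$, $\mathbb{Z}_+$ is the set of positive integers, $\Sigma_N=\{0,\dots,N-1\}$. Vectors are ordered coordinatewise; for an integer $k$, $\mathbf{k}=(k,\dots,k)$; $e_i$ are the standard basis vectors. A prebasis of dimension $d$ is any $n\in\mathbb{Z}_+^d$; put $N=\prod_i n[i]$ and, for $v\in\mathbb{Z}^d$, $m(n,v)=\prod_{j=1}^d n[j]^{-v[j]}$ (also called the weight $\mathrm{wgt}_n(v)$). For $a\in\mathbb{N}$ and $\mathbf{0}\ge v_1\ge v_2$ in $\mathbb{Z}^d$, $\mathrm{base}_n(a,(v_1,v_2))[2]$ denotes the integer $a_1$ in the unique representation $a=a_0+a_1m(n,v_1)+a_2m(n,v_2)$ with integers $0\le a_0<m(n,v_1)$, $0\le a_1<m(n,v_2)/m(n,v_1)$, $a_2\ge0$. For $a\in\Sigma_N$, the multiplication cube $\mathrm{cube}_n(a)$ is the function on pairs $v_1\ge v_2$ in $\{-1,0\}^d$ given by $\mathrm{cube}_n(a)[v_1,v_2]=\mathrm{base}_n(a,(v_1,v_2))[2]$. $T_n=\{\mathrm{cube}_n(a):a\in\Sigma_N\}$ and $\mathrm{val}_n(t)=t[\mathbf{0},-\mathbf{1}]$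 (so $\mathrm{val}_n(\mathrm{cube}_n(a))=a$). $X_n$ is the set of maps $f:\mathbb{Z}^d\to T_n$ such that $f[z][\mathbf{0},-\mathbf{1}+e_i]=f[z+e_i][-e_i,-\mathbf{1}]$ for all $z\in\mathbb{Z}^d$, $1\le i\le d$. The shift is $\sigma_v(f)[z]=f[z+v]$. The number represented by $f\in X_n$ is $\mathrm{real}(f)=\sum_{i=-\infty}^{\infty}N^i\,\mathrm{val}_n(f[-\mathbf{i}])\in[0,\infty]$, i.e. the number read in base $N$ from the main diagonal. *)

(* Defs.v *)
From HB Require Import structures.
From mathcomp Require Import all_boot all_order all_algebra.
From mathcomp Require Import all_classical all_reals all_analysis.

Set Implicit Arguments.
Unset Strict Implicit.
Unset Printing Implicit Defensive.

Import Order.TTheory GRing.Theory Num.Theory.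

Local Open Scope classical_set_scope.
Local Open Scope ring_scope.

Definition vle (d : nat) (v w : 'rV[int]_d) : bool :=
  [forall j, v 0 j <= w 0 j].

Definition basis_vec (d : nat) (i : 'I_d) : 'rV[int]_d := delta_mx 0 i.

Definition prebasis (d : nat) (n : 'I_d -> nat) : Prop :=
  forall j, (0 < n j)%N.

Definition base_size (d : nat) (n : 'I_d -> nat) : nat := (\prod_j n j)%N.

(* The weight is an integer only for [v <= 0], hence the field [F]. *)
Definition wgt (F : fieldType) (d : nat) (n : 'I_d -> nat) (v : 'rV[int]_d) :
    F :=
  \prod_j (n j)%:R ^ (- v 0 j).

Definition base_rep (d : nat) (n : 'I_d -> nat) (a : nat)
    (v1 v2 : 'rV[int]_d) (a0 a1 a2 : nat) : Prop :=
  [/\ a%:R = a0%:R + a1%:R * wgt rat n v1 + a2%:R * wgt rat n v2,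
      a0%:R < wgt rat n v1
    & a1%:R < wgt rat n v2 / wgt rat n v1].

(* Meaningful for [0 >= v1 >= v2], where the representation exists and is
   unique: see [base_rep_digit] and [base_rep_uniq]. *)
Definition base_digit (d : nat) (n : 'I_d -> nat) (a : nat)
    (v1 v2 : 'rV[int]_d) : nat :=
  xget 0%N [set a1 | exists a0 a2, base_rep n a v1 v2 a0 a1 a2].

Definition cube_vertex (d : nat) (v : 'rV[int]_d) : bool :=
  [forall j, (v 0 j == -1) || (v 0 j == 0)].

(* Functions on the pairs [v1 >= v2] of [{-1,0}^d] are represented by total
   functions vanishing outside of these pairs. *)
Definition cube_fun (d : nat) : Type := 'rV[int]_d -> 'rV[int]_d -> nat.

Definition cube (d : nat) (n : 'I_d -> nat) (a : nat) : cube_fun d :=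
  fun v1 v2 =>
    if [&& cube_vertex v1, cube_vertex v2 & vle v2 v1]
    then base_digit n a v1 v2 else 0%N.

Definition cubes (d : nat) (n : 'I_d -> nat) : set (cube_fun d) :=
  [set cube n a | a in [set a : nat | (a < base_size n)%N]].

Definition cube_val (d : nat) (t : cube_fun d) : nat := t 0 (const_mx (-1)).

Definition cube_shift_space (d : nat) (n : 'I_d -> nat) :
    set ('rV[int]_d -> cube_fun d) :=
  [set f | (forall z, cubes n (f z)) /\
     (forall z i, f z 0 (const_mx (-1) + basis_vec i) =
        f (z + basis_vec i) (- basis_vec i) (const_mx (-1)))].

Definition config_shift (d : nat) (v : 'rV[int]_d)
    (f : 'rV[int]_d -> cube_fun d) : 'rV[int]_d -> cube_fun d :=
  fun z => f (z + v).

Definition represented (R : realType) (d : nat) (n : 'I_d -> nat)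
    (f : 'rV[int]_d -> cube_fun d) : \bar R :=
  \esum_(i in [set: int])
    ((base_size n)%:R ^ i * (cube_val (f (const_mx (- i))))%:R)%:E.

Lemma wgt_natE (d : nat) (n : 'I_d -> nat) (v : 'rV[int]_d) :
  vle v 0 -> wgt rat n v = (\prod_j n j ^ absz (v 0%R j))%N%:R.
Proof.
move=> /forallP v0; rewrite /wgt natr_prod; apply: eq_bigr => j _.
have := v0 j; rewrite mxE => vj.
by rewrite natrX -[in LHS](ler0_norm vj) -abszE.
Qed.

Lemma wgt_dvd (d : nat) (n : 'I_d -> nat) (v1 v2 : 'rV[int]_d) :
  prebasis n -> vle v1 0 -> vle v2 v1 ->
  exists m q : nat, [/\ (0 < m)%N, (0 < q)%N, wgt rat n v1 = m%:R
    & wgt rat n v2 = (m * q)%N%:R].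
Proof.
move=> n0 v10 v21.
have v20 : vle v2 0.
  apply/forallP => j; apply: le_trans (forallP v10 j); exact: (forallP v21 j).
exists (\prod_j n j ^ absz (v1 0%R j))%N.
exists (\prod_j n j ^ (absz (v2 0%R j) - absz (v1 0%R j)))%N.
split; first by apply: prodn_gt0 => j; rewrite expn_gt0 n0.
- by apply: prodn_gt0 => j; rewrite expn_gt0 n0.
- exact: wgt_natE.
rewrite wgt_natE // -big_split /=; congr (_%:R); apply: eq_bigr => j _.
rewrite -expnD subnKC // -lez_nat !abszE.
have := forallP v10 j; have := forallP v20 j; rewrite !mxE => h2 h1.
by rewrite !ler0_norm // lerN2; exact: (forallP v21 j).
Qed.

Lemma base_rep_uniq (d : nat) (n : 'I_d -> nat) (a : nat)
    (v1 v2 : 'rV[int]_d) (a0 a1 a2 b0 b1 b2 : nat) :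
  prebasis n -> vle v1 0 -> vle v2 v1 ->
  base_rep n a v1 v2 a0 a1 a2 -> base_rep n a v1 v2 b0 b1 b2 ->
  [/\ a0 = b0, a1 = b1 & a2 = b2].
Proof.
move=> n0 v10 v21; have [m [q [m0 q0 E1 E2]]] := wgt_dvd n0 v10 v21.
have key c0 c1 c2 : base_rep n a v1 v2 c0 c1 c2 ->
    [/\ c0 = a %% m, c1 = (a %/ m) %% q & c2 = (a %/ m) %/ q]%N.
  rewrite /base_rep E1 E2 natrM mulrAC divff ?mul1r ?pnatr_eq0 -?lt0n//.
  rewrite -!natrM -!natrD !ltr_nat => -[/eqP].
  rewrite eqr_nat => /eqP -> c0m c1q.
  have -> : (c0 + c1 * m + c2 * (m * q) = (c2 * q + c1) * m + c0)%N.
    by rewrite mulnDl -mulnA (mulnC q) [LHS]addnC (addnC c0) addnA.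
  by rewrite modnMDl divnMDl // (divn_small c0m) addn0 modnMDl divnMDl //
    (divn_small c1q) addn0 !modn_small.
by move=> /key[-> -> ->] /key[-> -> ->].
Qed.

Lemma base_rep_digit (d : nat) (n : 'I_d -> nat) (a : nat)
    (v1 v2 : 'rV[int]_d) :
  prebasis n -> vle v1 0 -> vle v2 v1 ->
  exists a0 a2, base_rep n a v1 v2 a0 (base_digit n a v1 v2) a2.
Proof.
move=> n0 v10 v21; have [m [q [m0 q0 E1 E2]]] := wgt_dvd n0 v10 v21.
suff ex : [set a1 | exists a0 a2, base_rep n a v1 v2 a0 a1 a2]
    ((a %/ m) %% q)%N by exact: (xgetI 0%N ex).
exists (a %% m)%N, ((a %/ m) %/ q)%N.
rewrite /base_rep E1 E2 natrM mulrAC divff ?mul1r ?pnatr_eq0 -?lt0n//.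
rewrite -!natrM -!natrD !ltr_nat !ltn_mod; split => //; congr (_%:R).
by rewrite (mulnC m) mulnA -addnA -mulnDl [((_ %% q) + _)%N]addnC -divn_eq
  addnC -divn_eq.
Qed.

(* Main.v *)
(* Write [A z] for the value of the cube [f z], [N] for the product of all [n k],
   and [P] for [N / n i].  Composing the matching constraints of [f] along
   [z + e_i, ..., z + (1,...,1)] shows that [A (z + e_i) %% n i] is the leading
   part [A (z + (1,...,1)) %/ P], while [A (z + e_i) %/ n i] is the trailing
   part [A z %% P].  Summing over the diagonal and shifting the index of the
   leading parts by one, the factor [N = n i * P] recombines both parts into
   [n i] times the sum of [N ^ k * A (-k)].  All terms are nonnegative, so this
   holds in [[0, +oo]], and the general shift follows since shifts compose. *)

Require Import Defs.
From mathcomp Require Import all_boot all_order all_algebra.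
From mathcomp Require Import all_classical all_reals all_analysis.

Set Implicit Arguments.
Unset Strict Implicit.

Import Order.TTheory GRing.Theory Num.Theory.

Local Open Scope classical_set_scope.
Local Open Scope ring_scope.
Local Open Scope ereal_scope.

(** Scaling by a positive real commutes with the supremum of the finite partial sums, even when that
    supremum is infinite. *)
Lemma esumZl (R : realType) (T : choiceType) (I : set T) (a : T -> \bar R)
    (r : R) : (0 < r)%R -> (forall i, I i -> 0 <= a i) ->
  \esum_(i in I) (r%:E * a i) = r%:E * \esum_(i in I) a i.
Proof.
move=> r0 a0; rewrite /esum -ereal_sup_pZl//; congr ereal_sup.
rewrite image_comp; apply: eq_imagel => X [finX XI] /=.
rewrite !fsbig_finite//= big_seq [in RHS]big_seq ge0_sume_distrr// => i.
by rewrite in_fset_set// inE => /XI; exact: a0.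
Qed.

(** * Digits of a cube as quotients and remainders *)

Lemma base_digitE (d : nat) (n : 'I_d -> nat) (a : nat) (v1 v2 : 'rV[int]_d)
    (m q : nat) : prebasis n -> vle v1 0%R -> vle v2 v1 ->
  wgt rat n v1 = m%:R%R -> wgt rat n v2 = (m * q)%N%:R%R ->
  base_digit n a v1 v2 = ((a %/ m) %% q)%N.
Proof.
move=> n0 v10 v21 E1 E2.
have [a0 [a2]] := base_rep_digit a n0 v10 v21.
set a1 := base_digit _ _ _ _; rewrite /base_rep E1 E2 => -[].
rewrite -!natrM -!natrD !ltr_nat => /eqP; rewrite eqr_nat => /eqP -> a0m.
have m0 : (0 < m)%N by apply: leq_trans a0m.
rewrite natrM mulrAC divff ?mul1r ?pnatr_eq0 -?lt0n// ltr_nat => a1q.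
(* Division by [m] removes [a0]; reduction modulo [q] then removes [a2]. *)
rewrite mulnCA -addnA (mulnC a1) -mulnDr addnC mulnC.
by rewrite divnMDl// (divn_small a0m) addn0 addnC modnMDl modn_small.
Qed.

(** The number [P] of the overview, written as a product to avoid division. *)
Definition cosize (d : nat) (n : 'I_d -> nat) (i : 'I_d) : nat :=
  (\prod_(k | k != i) n k)%N.

Lemma base_sizeE (d : nat) (n : 'I_d -> nat) (i : 'I_d) :
  base_size n = (n i * cosize n i)%N.
Proof. by rewrite /base_size (bigD1 i). Qed.

Lemma vle_refl (d : nat) (v : 'rV[int]_d) : vle v v.
Proof. exact/forallP. Qed.

Lemma wgt0 (d : nat) (n : 'I_d -> nat) : wgt rat n 0%R = 1%:R%R.
Proof. by rewrite wgt_natE ?vle_refl// big1// => j _; rewrite mxE. Qed.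

Lemma wgtN1 (d : nat) (n : 'I_d -> nat) :
  wgt rat n (const_mx (-1)%R) = (base_size n)%:R%R.
Proof.
rewrite wgt_natE; last by apply/forallP => j; rewrite !mxE.
by congr (_%:R)%R; apply: eq_bigr => j _; rewrite mxE.
Qed.

Lemma wgtN_basis (d : nat) (n : 'I_d -> nat) (i : 'I_d) :
  wgt rat n (- basis_vec i)%R = (n i)%:R%R.
Proof.
rewrite wgt_natE; last by apply/forallP => j; rewrite !mxE ?eqxx; case: (j == i).
congr (_%:R)%R; rewrite (bigD1 i)//= big1 => [|j /negPf ji]; rewrite !mxE ?eqxx.
  by rewrite muln1.
by rewrite ji.
Qed.

Lemma wgtN1_basis (d : nat) (n : 'I_d -> nat) (i : 'I_d) :
  wgt rat n (const_mx (-1) + basis_vec i)%R = (cosize n i)%:R%R.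
Proof.
rewrite wgt_natE; last by apply/forallP => j; rewrite !mxE ?eqxx; case: (j == i).
congr (_%:R)%R; rewrite (bigD1 i)//= !mxE !eqxx mul1n.
by apply: eq_bigr => j /negPf ji; rewrite !mxE ji.
Qed.

Section CubeDigits.
Context (d : nat) (n : 'I_d -> nat) (hn : prebasis n).

Lemma cube_valE (a : nat) : (a < base_size n)%N -> cube_val (cube n a) = a.
Proof.
move=> aN; rewrite /cube_val /cube ifT; last first.
  by apply/and3P; split; apply/forallP => j; rewrite !mxE.
rewrite (@base_digitE _ _ _ _ _ 1%N (base_size n)) ?wgt0 ?wgtN1 ?mul1n//.
- by rewrite divn1 modn_small.
- by apply/forallP => j; rewrite !mxE.
- by apply/forallP => j; rewrite !mxE.
Qed.

Lemma cube_low (a : nat) (i : 'I_d) :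
  cube n a 0%R (const_mx (-1) + basis_vec i)%R = (a %% cosize n i)%N.
Proof.
rewrite /cube ifT; last first.
  by apply/and3P; split; apply/forallP => j; rewrite !mxE ?eqxx//; case: (j == i).
rewrite (@base_digitE _ _ _ _ _ 1%N (cosize n i)) ?wgt0 ?wgtN1_basis ?mul1n//.
- by rewrite divn1.
- by apply/forallP => j; rewrite !mxE.
- by apply/forallP => j; rewrite !mxE ?eqxx; case: (j == i).
Qed.

Lemma cube_high (a : nat) (i : 'I_d) : (a < base_size n)%N ->
  cube n a (- basis_vec i)%R (const_mx (-1)%R) = (a %/ n i)%N.
Proof.
move=> aN; rewrite /cube ifT; last first.
  by apply/and3P; split; apply/forallP => j; rewrite !mxE ?eqxx//; case: (j == i).
rewrite (@base_digitE _ _ _ _ _ (n i) (cosize n i)) ?wgtN_basis ?wgtN1 -?base_sizeE//.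
(* The reduction modulo [cosize n i] changes nothing, because [a] is below [n i * cosize n i]. *)
- by rewrite modn_small// ltn_divLR ?hn// mulnC -base_sizeE.
- by apply/forallP => j; rewrite !mxE ?eqxx; case: (j == i).
- by apply/forallP => j; rewrite !mxE ?eqxx; case: (j == i).
Qed.

(** * Matching constraints along lattice paths *)

Context (f : 'rV[int]_d -> cube_fun d) (hf : cube_shift_space n f).

Local Notation A z := (cube_val (f z)).

(** This is the matching constraint read through [cube_low] and [cube_high]; from here on only the
    values [A] matter. *)
Lemma cube_val_step (z : 'rV[int]_d) (i : 'I_d) :
  (A z %% cosize n i = A (z + basis_vec i)%R %/ n i)%N.
Proof.
have [ff fs] := hf; have := fs z i.
have [a aN <-] := ff z; have [b bN <-] := ff (z + basis_vec i)%R.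
by rewrite cube_low cube_high// !cube_valE.
Qed.

(** Each direction is used at most once, so every step strips a new factor of [base_size n] from the
    modulus and moves it to the divisor. *)
Lemma cube_val_path (s : seq 'I_d) (z : 'rV[int]_d) : uniq s ->
  (A z %% \prod_(k | k \notin s) n k =
   A (z + \sum_(k <- s) basis_vec k)%R %/ \prod_(k <- s) n k)%N.
Proof.
elim: s => [|i s IH] /=.
  (* On the empty path the modulus is all of [base_size n], which exceeds every value. *)
  rewrite !big_nil addr0 divn1 modn_small// -[X in (_ < X)%N]/(base_size n).
  by have [ff _] := hf; have [a aN <-] := ff z; rewrite cube_valE.
move=> /andP[iNs us].
have E : (\prod_(k | k \notin s) n k = n i * \prod_(k | k \notin i :: s) n k)%N.
  rewrite (bigD1 i)//=; congr (_ * _)%N; apply: eq_bigl => k.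
  by rewrite inE negb_or andbC.
have cE : (cosize n i = \prod_(k | k \notin i :: s) n k * \prod_(k <- s) n k)%N.
  rewrite (big_uniq _ us) /= /cosize (bigID (mem s))/= mulnC.
  congr (_ * _)%N; apply: eq_bigl => k; first by rewrite inE negb_or.
  case ks: (k \in s); rewrite ?andbF// andbT.
  by apply: contraNneq iNs => <-.
(* The step in direction [i] is taken last, from the endpoint of [s]; the factorisation [cE] then
   lets the division by the product over [s] pass inside the remainder. *)
rewrite !big_cons addrCA addrC divnMA -cube_val_step cE -modn_divl -IH//.
by rewrite E modn_dvdm// dvdn_mull.
Qed.

Lemma cube_val_basis (z : 'rV[int]_d) (i : 'I_d) :
  A (z + basis_vec i)%R =
  (n i * (A z %% cosize n i) + A (z + const_mx 1)%R %/ cosize n i)%N.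
Proof.
rewrite [LHS](divn_eq _ (n i)) -cube_val_step mulnC; congr (_ + _)%N.
(* The path takes every direction but [i]: from [z + e_i] it ends at [z + (1,...,1)], and the only
   factor left in its modulus is [n i]. *)
pose s := [seq k <- index_enum 'I_d | k != i].
have us : uniq s by rewrite filter_uniq// index_enum_uniq.
have := cube_val_path (z + basis_vec i)%R us; rewrite !big_filter => E.
rewrite [in RHS]/cosize.
have -> : (z + const_mx 1 = z + basis_vec i + \sum_(k | k != i) basis_vec k)%R.
  rewrite -addrA; congr (_ + _)%R.
  rewrite -(bigD1 i (P := xpredT) (F := @basis_vec d))//=.
  rewrite [LHS]row_sum_delta; apply: eq_bigr => k _.
  by rewrite mxE scale1r.
rewrite -E; congr (_ %% _)%N; rewrite (bigD1 i) ?big1//=.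
- by rewrite muln1.
- by move=> k; rewrite mem_filter mem_index_enum andbT negbK andbN.
- by rewrite mem_filter eqxx.
Qed.

End CubeDigits.

(** * Effect of shifts on the represented number *)

Lemma shift_space_shift (d : nat) (n : 'I_d -> nat)
    (f : 'rV[int]_d -> cube_fun d) (v : 'rV[int]_d) :
  cube_shift_space n f -> cube_shift_space n (config_shift v f).
Proof.
move=> [ff fs]; split => [z|z i]; first exact: ff.
by rewrite /config_shift fs addrAC.
Qed.

Lemma represented_basis (R : realType) (d : nat) (n : 'I_d -> nat)
    (f : 'rV[int]_d -> cube_fun d) (i : 'I_d) :
  prebasis n -> cube_shift_space n f ->
  represented R n (config_shift (basis_vec i) f) =
  (n i)%:R%:E * represented R n f.
Proof.
move=> hn hf; rewrite /represented /config_shift.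
set N := (base_size n)%:R%R : R; set P := cosize n i.
have NE : N = ((n i)%:R * P%:R)%R by rewrite /N (base_sizeE n i) natrM.
have ni0 : (0 < (n i)%:R :> R)%R by rewrite ltr0n hn.
have N0 : (0 < N)%R by rewrite ltr0n prodn_gt0.
pose A k := cube_val (f (const_mx (- k)%R)).
(* [a] collects the trailing parts and [b] the leading parts; adding [(1,...,1)] to the diagonal
   point of index [k] gives the one of index [k - 1]. *)
pose a k := (N ^ k * (A k %% P)%N%:R)%R.
pose b k := (N ^ k * (A (k - 1)%R %/ P)%N%:R)%R.
have a0 k : (0 <= a k)%R by rewrite mulr_ge0 ?ler0n// exprz_ge0// ltW.
have b0 k : (0 <= b k)%R by rewrite mulr_ge0 ?ler0n// exprz_ge0// ltW.
transitivity (\esum_(k in [set: int]) ((n i)%:R%:E * (a k)%:E + (b k)%:E)).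
  apply: eq_esum => k _; rewrite (cube_val_basis hn hf) -EFinM -EFinD.
  have -> : (const_mx (- k) + const_mx 1 = const_mx (- (k - 1)) :> 'rV[int]_d)%R.
    by apply/rowP => j; rewrite !mxE opprB addrC.
  by rewrite natrD natrM mulrDr mulrCA.
rewrite esumD; last 2 first.
- by move=> k _; rewrite mule_ge0 ?lee_fin// ltW.
- by move=> k _; rewrite lee_fin.
have -> : \esum_(k in [set: int]) (b k)%:E =
          \esum_(k in [set: int]) (b (k + 1)%R)%:E.
  apply: (reindex_esum _ _ (fun k => k + 1)%R); split=> //.
  - by move=> x y _ _ /addIr.
  - by move=> y _; exists (y - 1)%R => //; rewrite subrK.
rewrite esumZl//; last by move=> k _; rewrite lee_fin.
have -> : \esum_(k in [set: int]) (b (k + 1)%R)%:E =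
    (n i)%:R%:E * \esum_(k in [set: int]) (N ^ k * P%:R * (A k %/ P)%N%:R)%:E.
  rewrite -esumZl//; last first.
    by move=> k _; rewrite lee_fin !mulr_ge0 ?ler0n// exprz_ge0// ltW.
  (* The reindexing leaves one extra factor [N], which splits into the common factor [n i] and the
     place value [P] of the leading part. *)
  apply: eq_esum => k _; rewrite /b addrK expfzDr ?gt_eqF// expr1z -EFinM {2}NE.
  by congr _%:E; rewrite !mulrA (mulrC (N ^ k)%R).
rewrite -ge0_muleDr; last 2 first.
- by apply: esum_ge0 => k _; rewrite lee_fin.
- apply: esum_ge0 => k _.
  by rewrite lee_fin !mulr_ge0 ?ler0n// exprz_ge0// ltW.
rewrite -esumD; last 2 first.
- by move=> k _; rewrite lee_fin.
- by move=> k _; rewrite lee_fin !mulr_ge0 ?ler0n// exprz_ge0// ltW.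
congr (_ * _); apply: eq_esum => k _.
rewrite -EFinD; congr _%:E; rewrite /a -mulrA -mulrDr -natrM -natrD.
by rewrite mulnC addnC -divn_eq.
Qed.

Lemma wgt_gt0 (R : realType) (d : nat) (n : 'I_d -> nat) (v : 'rV[int]_d) :
  prebasis n -> (0 < wgt R n v)%R.
Proof. by move=> hn; apply: prodr_gt0 => j _; rewrite exprz_gt0// ltr0n hn. Qed.

Lemma wgtD (R : realType) (d : nat) (n : 'I_d -> nat) (v w : 'rV[int]_d) :
  prebasis n -> wgt R n (v + w)%R = (wgt R n v * wgt R n w)%R.
Proof.
move=> hn; rewrite /wgt -big_split/=; apply: eq_bigr => j _.
by rewrite mxE opprD expfzDr// pnatr_eq0 -lt0n hn.
Qed.

Lemma represented_shift (R : realType) (d : nat) (n : 'I_d -> nat)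
    (v : 'rV[int]_d) (f : 'rV[int]_d -> cube_fun d) :
  prebasis n -> cube_shift_space n f ->
  represented R n (config_shift v f) = (wgt R n (- v)%R)%:E * represented R n f.
Proof.
(* The vectors satisfying [P] form a subgroup containing the basis. Quantifying over [f] allows the
   law to be applied to shifted configurations. *)
move=> hn; pose P v := forall f, cube_shift_space n f ->
  represented R n (config_shift v f) = (wgt R n (- v)%R)%:E * represented R n f.
suff: P v by exact.
have w0 : wgt R n 0%R = 1%R by rewrite /wgt big1// => j _; rewrite mxE.
have P0 : P 0%R.
  move=> g hg; rewrite oppr0 w0 mul1e; congr represented.
  by apply/funext => z; rewrite /config_shift addr0.
have PD u w : P u -> P w -> P (u + w)%R.
  move=> Pu Pw g hg.
  have -> : config_shift (u + w)%R g = config_shift u (config_shift w g).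
    by apply/funext => z; rewrite /config_shift addrA.
  rewrite Pu ?Pw//; last exact: shift_space_shift.
  by rewrite muleA -EFinM opprD wgtD.
have PN w : P w -> P (- w)%R.
  move=> Pw g hg.
  (* Shifting by [- w] and then by [w] gives back [g], and the two finite weights multiply to 1. *)
  have /Pw : cube_shift_space n (config_shift (- w)%R g).
    exact: shift_space_shift.
  have -> : config_shift w (config_shift (- w)%R g) = g.
    by apply/funext => z; rewrite /config_shift addrK.
  by move=> ->; rewrite muleA -EFinM -wgtD// addNr w0 mul1e.
have Pe i : P (basis_vec i).
  move=> g hg; rewrite represented_basis//; congr (_%:E * _).
  rewrite /wgt (bigD1 i)//= big1 => [|j /negPf ji]; rewrite !mxE ?eqxx ?opprK.
    by rewrite mulr1 expr1z.
  by rewrite ji expr0z.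
have PM i k : P (basis_vec i *+ k)%R.
  by elim: k => [|k IH]; rewrite ?mulr0n// mulrS; exact: PD.
rewrite [v]row_sum_delta; apply: big_ind => // i _.
(* An integer coordinate is [k] or [-(k + 1)] with [k] natural, so multiples and opposites
   suffice. *)
rewrite -[v _ _]intz scaler_int; case: (v _ _) => k; first exact: PM.
by rewrite NegzE mulrNz; apply: PN; exact: PM.
Qed.

Theorem proposition4p26 (R : realType) (d : nat) (n : 'I_d -> nat)
    (hn : prebasis n) (f : 'rV[int]_d -> cube_fun d)
    (hf : cube_shift_space n f) (hfin : represented R n f < +oo)
    (v : 'rV[int]_d) :
  represented R n (config_shift v f) = (wgt R n (- v)%R)%:E * represented R n f.
Proof. exact: represented_shift. Qed.
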